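(* Let $q\ge1$, let $A=(a_1,\ldots,a_q)$ and $B=(b_1,\ldots,b_q)$ be vectors of positive real numbers, and suppose that $\sum_{j=1}^{q}(t^{a_j}-t^{b_j})\ge0$ for all $t\in(0,1]$ (or that $B\prec^W A$). Then, with $f_1=\prod_{i=1}^{q}(a_i/b_i)$, $$e^{-f_1x}\le{}_qF_q(A;B;-x)\le 1-f_1+f_1e^{-x}$$ for all real $x$.
   Context: ${}_qF_q(A;B;x)=\sum_{n\ge 0}\frac{(a_1)_n\cdots(a_q)_n}{(b_1)_n\cdots(b_q)_n\,n!}x^n$, where $(a)_0=1$, $(a)_n=a(a+1)\cdots(a+n-1)$. Weak supermajorization $B\prec^W A$ (with $A$, $B$ each arranged in ascending order) means: $0<a_1\le a_2\le\cdots\le a_q$, $0<b_1\le b_2\le\cdots\le b_q$ and $\sum_{i=1}^{k}a_i\le\sum_{i=1}^{k}b_i$ for $k=1,2,\ldots,q$. *)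

(* Defs.v *)
From HB Require Import structures.
From mathcomp Require Import all_boot all_order all_algebra.
From mathcomp Require Import all_classical all_reals all_analysis.

Set Implicit Arguments.
Unset Strict Implicit.
Unset Printing Implicit Defensive.

Import Order.TTheory GRing.Theory Num.Theory.
Import numFieldNormedType.Exports.

Local Open Scope ring_scope.

Definition pochhammer (R : realType) (a : R) (n : nat) : R :=
  \prod_(k < n) (a + k%:R).

Definition qFq_coeff (R : realType) (q : nat) (A B : q.-tuple R) (n : nat) : R :=
  (\prod_(j < q) pochhammer (tnth A j) n) /
  ((\prod_(j < q) pochhammer (tnth B j) n) * n`!%:R).

(* [limn] is total; for positive parameters the series converges for every
   [x], so this is its sum. *)
Definition qFq (R : realType) (q : nat) (A B : q.-tuple R) (x : R) : R :=
  limn (pseries (qFq_coeff A B) x).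

(* [B \prec^W A]. The vectors are not assumed to be
   sorted: both are first arranged in ascending order. Note that the sums for
   [A] are the smaller ones. *)
Definition weak_supermaj (R : realType) (q : nat) (B A : q.-tuple R) : Prop :=
  let sA := sort <=%R A in
  let sB := sort <=%R B in
  [/\ forall i : 'I_q, 0 < sA`_i,
      forall i : 'I_q, 0 < sB`_i &
      forall k : nat, (1 <= k <= q)%N ->
        \sum_(i < k) sA`_i <= \sum_(i < k) sB`_i].

(* Main.v *)
(* Put f_n = prod_j (a_j)_n / (b_j)_n. If f is the moment sequence of a
   probability measure mu on [0, 1], then qFq(A; B; -x) is the integral of
   exp (-x t) against mu, and both bounds follow from the convexity of exp:
   the lower one is Jensen's inequality, the upper one compares exp (-x t) with
   its chord over [0, 1].

   Instead of mu we use the complete monotonicity of f: if mu exists, the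
   iterated differences of f are the integrals of t^k (1 - t)^(m - k), so with
   binomial weights they form a probability measure on {k/m} of mean f_1. Its
   generating function at 1 - x/m is sum_n C(m, n) (-x/m)^n f_n, which tends to
   qFq(A; B; -x).

   Complete monotonicity of f comes from a discrete Frullani formula. With
   Phi(t) = sum_j (t^a_j - t^b_j) and t_i = e^(-i d), the series of ln (1 - x)
   gives
     exp (- sum_(i >= 1) (1 - t_i^n) Phi(t_i) / (i (1 - t_i)))
     = prod_(k < n) prod_j (1 - e^(-(a_j + k) d)) / (1 - e^(-(b_j + k) d)),
   which tends to f_n as d -> 0; the left-hand side is completely monotone in n
   because Phi >= 0 on (0, 1]. Weak supermajorization implies Phi >= 0 by
   Tomic's inequality, proved by Abel summation. *)
Require Import Defs.
From HB Require Import structures.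
From mathcomp Require Import all_boot all_order all_algebra.
From mathcomp Require Import all_classical all_reals all_analysis.
From mathcomp Require Import ring lra.
Import Order.TTheory GRing.Theory Num.Theory.
Import numFieldNormedType.Exports.
Local Open Scope ring_scope.

(** * The exponential as a limit of compound powers *)

Lemma cvg_1D_div {R : realType} (y : R) :
  (1 + y / n.+1%:R @[n --> \oo] --> (1 : R))%classic.
Proof.
rewrite -[X in (_ --> X)%classic]addr0 -[X in (_ + X)](mulr0 y).
apply: cvgD; first exact: cvg_cst.
by apply: cvgM; [exact: cvg_cst | exact: cvg_harmonic].
Qed.

(** Squeeze: with z = y/(n+1) > -1, 1 + z <= e^z, and the same inequality at -z/(1+z), inverted,
    gives e^(z/(1+z)) <= 1 + z. This covers both signs of y. *)
Lemma cvg_expR_compound {R : realType} (y : R) :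
  ((1 + y / n.+1%:R) ^+ n.+1 @[n --> \oo] --> expR y)%classic.
Proof.
have lower : (expR (y / (1 + y / n.+1%:R)) @[n --> \oo] --> expR y)%classic.
  apply: continuous_cvg; first exact: continuous_expR.
  rewrite -[X in (_ --> X)%classic]divr1; apply: cvgM; first exact: cvg_cst.
  by apply: cvgV; [exact: oner_neq0 | exact: cvg_1D_div].
apply: (squeeze_cvgr _ lower (cvg_cst _)).
near=> n.
have n_neq0 : n.+1%:R != 0 :> R by rewrite pnatr_eq0.
have pos : 0 < 1 + y / n.+1%:R by near: n; exact: (cvgr_gt 1 (cvg_1D_div y)).
move: pos; set z := y / n.+1%:R => pos.
have -> : y = n.+1%:R * z by rewrite mulrC divfK.
rewrite -mulrA !expRM_natl !lerXn2r ?nnegrE ?expR_ge0 ?(ltW pos) //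
  ?expR_ge1Dx //=.
rewrite -[leRHS]invrK -[leLHS]invrK lef_pV2 ?posrE ?invr_gt0 ?expR_gt0 //.
rewrite -expRN; apply: le_trans (expR_ge1Dx _).
suff <- : (1 + z)^-1 = 1 - z / (1 + z) by exact: lexx.
by field; rewrite gt_eqF.
Unshelve. all: by end_near.
Qed.

(** * Completely monotone sequences and their closure properties *)

(** The negated forward difference, which absorbs the signs (-1)^p of complete monotonicity. *)
Definition diffb {R : realType} (u : nat -> R) (n : nat) : R := u n - u n.+1.

Definition completely_monotone {R : realType} (u : nat -> R) : Prop :=
  forall p n, 0 <= iter p diffb u n.

Section CompletelyMonotone.
Context {R : realType}.
Implicit Types u v : nat -> R.
Local Notation cm := (@completely_monotone R).

Lemma iter_diffbD p u v n :
  iter p diffb (fun k => u k + v k) n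
  = iter p diffb u n + iter p diffb v n.
Proof. by elim: p n => //= p IH n; rewrite /diffb !IH; ring. Qed.

Lemma iter_diffbZ p c u n :
  iter p diffb (fun k => c * u k) n = c * iter p diffb u n.
Proof. by elim: p n => //= p IH n; rewrite /diffb !IH; ring. Qed.

Lemma iter_diffb_shift p u n :
  iter p diffb (fun k => u k.+1) n = iter p diffb u n.+1.
Proof. by elim: p n => //= p IH n; rewrite /diffb !IH. Qed.

Lemma iter_diffbX p (t : R) n :
  iter p diffb (fun k => t ^+ k) n = t ^+ n * (1 - t) ^+ p.
Proof.
elim: p n => /= [|p IH] n; first by rewrite expr0 mulr1.
by rewrite /diffb !IH !exprS; ring.
Qed.

Lemma cm_diffb u : cm u -> cm (diffb u).
Proof. by move=> cu p n; rewrite -iterSr; apply: cu. Qed.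

Lemma cm_shift u : cm u -> cm (fun n => u n.+1).
Proof. by move=> cu p n; rewrite iter_diffb_shift. Qed.

Lemma cmD u v : cm u -> cm v -> cm (fun n => u n + v n).
Proof. by move=> cu cv p n; rewrite iter_diffbD addr_ge0. Qed.

Lemma cmZ (c : R) u : 0 <= c -> cm u -> cm (fun n => c * u n).
Proof. by move=> c0 cu p n; rewrite iter_diffbZ mulr_ge0. Qed.

Lemma cmX (t : R) : 0 <= t <= 1 -> cm (fun n => t ^+ n).
Proof.
by move=> /andP[t0 t1] p n; rewrite iter_diffbX mulr_ge0 ?exprn_ge0 ?subr_ge0.
Qed.

Lemma cm1 : cm (fun=> 1 : R).
Proof.
by have -> : (fun=> 1) = (fun n => 1 ^+ n) :> (nat -> R);
  [apply/funext => n; rewrite expr1n | apply: cmX; rewrite ler01 lexx].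
Qed.

Lemma cm_sum (I : Type) (r : seq I) (F : I -> nat -> R) :
  (forall i, cm (F i)) -> cm (fun n => \sum_(i <- r) F i n).
Proof.
move=> cF; elim: r => [|i r IH].
  have -> : (fun n => \sum_(i <- [::]) F i n) = (fun n => 0 * 1).
    by apply/funext => n; rewrite big_nil mul0r.
  exact: cmZ (lexx _) cm1.
have -> : (fun n => \sum_(j <- i :: r) F j n)
        = (fun n => F i n + \sum_(j <- r) F j n).
  by apply/funext => n; rewrite big_cons.
exact: cmD.
Qed.

(** Discrete Leibniz rule: one difference of a product is a sum of two products of completely
    monotone sequences, so the induction generalizes over [u] and [v]. *)
Lemma cmM u v : cm u -> cm v -> cm (fun n => u n * v n).
Proof.
move=> cu cv p; elim: p u v cu cv => [|p IH] u v cu cv n /=.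
  by rewrite mulr_ge0 ?(cu 0) ?(cv 0).
rewrite -iterS iterSr.
have -> : diffb (fun k => u k * v k)
        = (fun k => diffb u k * v k + u k.+1 * diffb v k).
  by apply/funext => k; rewrite /diffb; ring.
rewrite iter_diffbD addr_ge0 ?IH //; try exact: cm_diffb.
exact: cm_shift.
Qed.

Lemma cm_exprn u N : cm u -> cm (fun n => u n ^+ N).
Proof.
move=> cu; elim: N => [|N IH]; first exact: cm1.
have -> : (fun n => u n ^+ N.+1) = (fun n => u n * u n ^+ N).
  by apply/funext => n; rewrite exprS.
exact: cmM.
Qed.

Lemma cm_lim (v : nat -> nat -> R) u : (forall m, cm (v m)) ->
  (forall n, (v m n @[m --> \oo] --> u n)%classic) -> cm u.
Proof.
move=> cv vu p n.
have vup : (iter p diffb (v m) n @[m --> \oo]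
            --> iter p diffb u n)%classic.
  by elim: p n => //= p IH n; apply: cvgB; exact: IH.
by apply: (cvgr_to_ge vup); apply: nearW => m; exact: cv.
Qed.

(** Pointwise limit of the powers (1 + u/N)^N, which are completely monotone by closure under
    products. *)
Lemma cm_expR u : cm u -> cm (fun n => expR (u n)).
Proof.
move=> cu; apply: (@cm_lim (fun N n => (1 + u n / N.+1%:R) ^+ N.+1)).
  move=> N; apply: cm_exprn.
  have -> : (fun n => 1 + u n / N.+1%:R) = (fun n => 1 + N.+1%:R^-1 * u n).
    by apply/funext => n; rewrite mulrC.
  by apply: (cmD _ _ cm1); apply: cmZ => //; rewrite invr_ge0.
by move=> n; exact: cvg_expR_compound.
Qed.

(** Serves later to dominate generating series by the exponential series. *)
Lemma cm_le0 u n : cm u -> 0 <= u n <= u 0%N.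
Proof.
move=> cu; rewrite (cu 0 n) /=; elim: n => // n IH.
by apply: le_trans IH; rewrite -subr_ge0; exact: (cu 1%N n).
Qed.

End CompletelyMonotone.

(** * The logarithm series and the limits of (1 - e^(-a d)) / (1 - e^(-b d)) *)

(** The remainder [g N] vanishes at 0 and has derivative -y^N / (1 - y), so the mean value theorem
    bounds it by x^N / (1 - x). *)
Lemma cvg_ln1B_series {R : realType} (x : R) : 0 <= x < 1 ->
  (\sum_(i < N) x ^+ i.+1 / i.+1%:R @[N --> \oo] --> - ln (1 - x))%classic.
Proof.
move=> /andP[x0 x1].
pose P (N : nat) (y : R) := \sum_(i < N) y ^+ i.+1 / i.+1%:R.
have dP (N : nat) (y : R) : is_derive y (1 : R) (P N) (\sum_(i < N) y ^+ i).
  have -> : P N = \sum_(i < N) (fun y : R => y ^+ i.+1 / i.+1%:R).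
    by apply/funext => z; rewrite fct_sumE.
  apply: is_derive_sum => i.
  have -> : (fun y : R => y ^+ i.+1 / i.+1%:R) = i.+1%:R^-1 \*: (id ^+ i.+1).
    by apply/funext => z; rewrite /= mulrC exprfctE.
  apply: is_derive_eq.
  by rewrite scaler1 /= scalerA mulVf ?scale1r // pnatr_eq0.
have dln (y : R) : y < 1 ->
    is_derive y (1 : R) (fun y : R => ln (1 - y)) (- (1 - y)^-1).
  move=> y1; have pos : 0 < 1 - y by rewrite subr_gt0.
  have dl := is_derive1_ln pos.
  have ds : is_derive y (1 : R) (cst 1 - id : R -> R) (-1).
    by apply: is_derive_eq; rewrite sub0r.
  have := is_derive1_comp (g := cst 1 - id : R -> R) dl ds.
  by rewrite mulrN1.
pose g N := (fun y : R => ln (1 - y)) + P N.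
have dg (N : nat) (y : R) : y < 1 ->
    is_derive y (1 : R) (g N) (- (y ^+ N / (1 - y))).
  move=> y1; have pos : 0 < 1 - y by rewrite subr_gt0.
  apply: is_derive_eq (is_deriveD (dln y y1) (dP N y)) _.
  apply: (mulIf (lt0r_neq0 pos)).
  rewrite mulrDl !mulNr mulVf ?lt0r_neq0 // divfK ?lt0r_neq0 //.
  by have := subrX1 y N; nra.
have bound N : `|g N x| <= x ^+ N / (1 - x).
  have [||c] := @MVT_segment R (g N) (fun y => - (y ^+ N / (1 - y))) 0 x x0.
  - move=> y; rewrite in_itv /= => /andP[_ yx].
    by apply: dg; apply: lt_trans x1.
  - apply: derivable_within_continuous => y; rewrite in_itv /= => /andP[_ yx].
    by apply: ex_derive; apply: dg; apply: le_lt_trans x1.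
  rewrite in_itv /= => /andP[c0 cx].
  have -> : g N 0 = 0.
    rewrite /g /P /= !fctE subr0 ln1 add0r big1 // => i _.
    by rewrite expr0n mul0r.
  rewrite !subr0 => ->.
  have c1 : c < 1 by apply: le_lt_trans x1.
  have dc0 : 0 <= c ^+ N / (1 - c).
    by rewrite divr_ge0 ?exprn_ge0 // subr_ge0 ltW.
  rewrite mulNr normrN normrM !ger0_norm //.
  rewrite -[leRHS]mulr1; apply: ler_pM => //.
  - apply: ler_pM; rewrite ?exprn_ge0 ?invr_ge0 ?subr_ge0 ?(ltW c1) //.
    + by rewrite lerXn2r ?nnegrE.
    + by rewrite lef_pV2 ?posrE ?subr_gt0 // lerB.
  - exact: ltW.
have g0 : (g N x @[N --> \oo] --> (0 : R))%classic.
  apply/norm_cvg0P.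
  apply: (squeeze_cvgr (f := fun=> 0) (h := fun N => x ^+ N / (1 - x))).
  - by apply: nearW => N; rewrite normr_ge0 bound.
  - exact: cvg_cst.
  - rewrite -[X in (_ --> X)%classic](mul0r (1 - x)^-1).
    apply: cvgM; last exact: cvg_cst.
    by apply: cvg_expr; rewrite ger0_norm.
have -> : (fun N => \sum_(i < N) x ^+ i.+1 / i.+1%:R)
        = (fun N => g N x - ln (1 - x)).
  by apply/funext => N; rewrite /g /P /= fctE; ring.
rewrite -[X in (_ --> X)%classic]add0r; apply: cvgB => //; exact: cvg_cst.
Qed.

(** Squeeze from z e^(-z) <= 1 - e^(-z) <= z with z = a/(n+1). *)
Lemma cvg_1BexpR {R : realType} (a : R) : 0 <= a ->
  ((1 - expR (- (a / n.+1%:R))) * n.+1%:R @[n --> \oo] --> a)%classic.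
Proof.
move=> a0.
apply: (squeeze_cvgr (f := fun n => a * expR (- (a / n.+1%:R))) (h := fun=> a)).
- apply: nearW => n; set z := a / n.+1%:R.
  have -> : a = z * n.+1%:R by rewrite divfK ?pnatr_eq0.
  rewrite mulrAC !ler_pM2r ?ltr0n //; apply/andP; split; last first.
    by have := expR_ge1Dx (- z); lra.
  have := expR_ge1Dx z; have := expRxMexpNx_1 z; have := expR_gt0 (- z); nra.
- have e : a = a * expR (- (a * 0)) by rewrite mulr0 oppr0 expR0 mulr1.
  rewrite [X in (_ --> X)%classic]e.
  apply: cvgM; first exact: cvg_cst.
  apply: continuous_cvg; first exact: continuous_expR.
  by apply: cvgN; apply: cvgM; [exact: cvg_cst | exact: cvg_harmonic].
- exact: cvg_cst.
Qed.

Lemma cvg_1BexpR_ratio {R : realType} (a b : R) : 0 < a -> 0 < b ->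
  ((1 - expR (- (a / n.+1%:R))) / (1 - expR (- (b / n.+1%:R)))
    @[n --> \oo] --> a / b)%classic.
Proof.
move=> a0 b0.
have -> : (fun n => (1 - expR (- (a / n.+1%:R))) / (1 - expR (- (b / n.+1%:R))))
  = (fun n => ((1 - expR (- (a / n.+1%:R))) * n.+1%:R)
            / ((1 - expR (- (b / n.+1%:R))) * n.+1%:R)).
  by apply/funext => n; rewrite -mulf_div divff ?mulr1 // pnatr_eq0.
apply: cvgM; first exact/cvg_1BexpR/ltW.
by apply: cvgV; [rewrite gt_eqF | exact/cvg_1BexpR/ltW].
Qed.

(** * Complete monotonicity of the Pochhammer ratios by the discrete Frullani formula *)

Lemma cm_pochhammer_ratio {R : realType} (I : finType) (a b : I -> R) :
  (forall j, 0 < a j) -> (forall j, 0 < b j) ->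
  (forall t : R, 0 < t <= 1 -> 0 <= \sum_j (t `^ a j - t `^ b j)) ->
  completely_monotone
    (fun n => \prod_j (pochhammer (a j) n / pochhammer (b j) n)).
Proof.
move=> a0 b0 ab.
(* The step of the discretization is d = 1/(m+1), so [e m c] is e^(-c d). *)
pose e m (c : R) := expR (- (c / m.+1%:R)).
have e_itv m c : 0 < c -> 0 <= e m c < 1.
  by move=> c0; rewrite expR_ge0 expR_lt1 oppr_lt0 divr_gt0.
pose w m n := \prod_(k < n) \prod_j
  ((1 - e m (a j + k%:R)) / (1 - e m (b j + k%:R))).
apply: (@cm_lim _ w) => [m|n]; last first.
  have -> : \prod_j (pochhammer (a j) n / pochhammer (b j) n)
          = \prod_(k < n) \prod_j ((a j + k%:R) / (b j + k%:R)).
    rewrite exchange_big; apply: eq_bigr => j _.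
    by rewrite /pochhammer -prodf_div.
  apply: cvg_big => [|k _]; first exact: mul_continuous.
  apply: cvg_big => [|j _]; first exact: mul_continuous.
  by apply: cvg_1BexpR_ratio; rewrite ltr_pwDl.
(* The index is shifted by one: [t i] is e^(-(i+1) d), which keeps 1 - [t i] nonzero. *)
pose t (i : nat) := e m i.+1%:R.
pose Phi i := \sum_j (t i `^ a j - t i `^ b j).
pose c i := Phi i / i.+1%:R / (1 - t i).
have t_itv i : 0 <= t i < 1 by apply: e_itv.
have tX i x : t i `^ x = e m x ^+ i.+1.
  rewrite /powR gt_eqF ?expR_gt0 // expRK /e -expRM_natl; congr expR.
  by ring.
have c_ge0 i : 0 <= c i.
  have /andP[t_ge0 t_lt1] := t_itv i.
  rewrite !divr_ge0 ?subr_ge0 ?(ltW t_lt1) //; apply: ab.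
  by rewrite expR_gt0 ltW.
(* For fixed [m] the Frullani sum is cut at [N]. The exponent is then a constant, which becomes a
   positive factor, plus a nonnegative combination of powers t_i^n. *)
apply: (@cm_lim _ (fun N n => expR (\sum_(i < N) c i * (t i ^+ n - 1))))
  => [N|n].
  have -> : (fun n => expR (\sum_(i < N) c i * (t i ^+ n - 1)))
    = (fun n => expR (- \sum_(i < N) c i) * expR (\sum_(i < N) c i * t i ^+ n)).
    apply/funext => n; rewrite -expRD; congr expR.
    rewrite addrC -sumrB; apply: eq_bigr => i _; by rewrite mulrBr mulr1.
  apply: cmZ; first exact: expR_ge0.
  apply: cm_expR; apply: cm_sum => i; apply: cmZ => //; apply: cmX.
  by have /andP[-> /ltW ->] := t_itv i.
(* The geometric sum replaces (1 - t^n) / (1 - t) by the sum of t^k over k < n. Since t_i^x t_i^k is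
   a power of e^(-(x + k) d), truncated logarithm series appear. *)
have -> : (fun N => expR (\sum_(i < N) c i * (t i ^+ n - 1)))
  = (fun N => expR (\sum_(k < n) \sum_j
      (\sum_(i < N) e m (b j + k%:R) ^+ i.+1 / i.+1%:R
       - \sum_(i < N) e m (a j + k%:R) ^+ i.+1 / i.+1%:R))).
  apply/funext => N; congr expR.
  transitivity (\sum_(k < n) \sum_j \sum_(i < N)
    (e m (b j + k%:R) ^+ i.+1 / i.+1%:R
     - e m (a j + k%:R) ^+ i.+1 / i.+1%:R)); last first.
    by apply: eq_bigr => k _; apply: eq_bigr => j _; rewrite sumrB.
  under [RHS]eq_bigr => k _ do rewrite exchange_big /=.
  rewrite exchange_big /=; apply: eq_bigr => i _.
  have /andP[_ t_lt1] := t_itv i.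
  rewrite subrX1 /c mulrA -[t i - 1]opprB mulrN divfK ?subr_eq0 ?gt_eqF //.
  rewrite mulr_sumr.
  apply: eq_bigr => k _; rewrite /Phi !(mulr_suml, =^~ sumrN).
  apply: eq_bigr => j _.
  have eD x : e m (x + k%:R) ^+ i.+1 = t i `^ x * t i ^+ k.
    by rewrite tX /t /e -!expRM_natl -expRD; congr expR; ring.
  rewrite (eD (a j)) (eD (b j)).
  move: (t i `^ a j) (t i `^ b j) (t i ^+ k) (i.+1%:R^-1).
  clear => x y z u; ring.
have -> : w m n = expR (\sum_(k < n) \sum_j
    (- ln (1 - e m (b j + k%:R)) - - ln (1 - e m (a j + k%:R)))).
  rewrite expR_sum; apply: eq_bigr => k _.
  rewrite expR_sum; apply: eq_bigr => j _.
  have e1 x : 0 < x -> 1 - e m (x + k%:R) \is Num.pos.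
    move=> x0; rewrite posrE subr_gt0.
    by have /andP[] := e_itv m _ (ltr_pwDl x0 (ler0n R k)).
  by rewrite expRB !expRN !lnK ?e1 // invrK mulrC.
apply: continuous_cvg; first exact: continuous_expR.
apply: cvg_big => [|k _]; first exact: add_continuous.
apply: cvg_big => [|j _]; first exact: add_continuous.
by apply: cvgB; apply: cvg_ln1B_series; apply: e_itv; rewrite ltr_pwDl.
Qed.

(** * The moment functional on polynomials *)

(** Stands in for integration of p against the measure with moments [f]; it is faithful for degrees
    below [N]. *)
Definition moment {R : realType} (f : nat -> R) (N : nat) (p : {poly R}) : R :=
  \sum_(i < N) p`_i * f i.

Section Moment.
Context {R : realType} (f : nat -> R) (N : nat).
Local Notation L := (moment f N).

Lemma momentZ c p : L (c *: p) = c * L p.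
Proof. by rewrite mulr_sumr; apply: eq_bigr => i _; rewrite coefZ mulrA. Qed.

Lemma moment_sum (I : Type) (r : seq I) (F : I -> {poly R}) :
  L (\sum_(i <- r) F i) = \sum_(i <- r) L (F i).
Proof.
rewrite exchange_big; apply: eq_bigr => i _ /=.
by rewrite coef_sum mulr_suml.
Qed.

Lemma momentB p q : L (p - q) = L p - L q.
Proof. by rewrite -sumrB; apply: eq_bigr => i _; rewrite coefB mulrBl. Qed.

Lemma momentXn k : (k < N)%N -> L 'X^k = f k.
Proof.
move=> kN; rewrite /moment (bigD1 (Ordinal kN)) //= coefXn eqxx mul1r.
rewrite big1 ?addr0 // => i /negbTE ik; rewrite coefXn.
by rewrite -(inj_eq val_inj) /= in ik; rewrite ik mul0r.
Qed.

(** Multiplying by 1 - X splits X^k (1 - X)^p exactly as [diffb] splits the sequence. *)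
Lemma moment_bernstein p k : (k + p < N)%N ->
  L ('X^k * (1 - 'X) ^+ p) = iter p diffb f k.
Proof.
elim: p k => [|p IH] k kpN.
  by rewrite mulr1 momentXn ?(leq_trans _ kpN) ?addn0.
have kpN' : (k + p < N)%N by apply: leq_trans kpN; rewrite addnS.
rewrite /= /diffb -(IH _ kpN') -IH ?addSnnS //.
by rewrite -momentB; congr (L _); rewrite !exprS; ring.
Qed.

End Moment.

(** * Bernstein weights and the two convexity bounds *)

(** The tangent line at th u lies below the exponential at 0 and at u; averaging these with weights
    1 - th and th cancels the slope. *)
Lemma expR_le_chord {R : realType} (th u : R) : 0 <= th <= 1 ->
  expR (th * u) <= 1 - th + th * expR u.
Proof.
move=> /andP[th0 th1].
have e1 : expR (th * u) * expR (- (th * u)) = 1 by rewrite expRxMexpNx_1.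
have eu : expR (th * u) * expR (u - th * u) = expR u.
  by rewrite -expRD addrC subrK.
have p0 := expR_gt0 (th * u).
have := expR_ge1Dx (- (th * u)); rewrite -(ler_pM2l p0) e1 => h1.
have := expR_ge1Dx (u - th * u); rewrite -(ler_pM2l p0) eu => h2.
by move: (expR _) p0 h1 h2 {e1 eu} => E p0; move: (expR u) => F h1 h2; nra.
Qed.

Section Hausdorff.
Context {R : realType} (f : nat -> R).
Hypotheses (cf : completely_monotone f) (f0 : f 0%N = 1).

(* The mass at [k / m] of the [m]-th Bernstein approximation of the measure on
   [0, 1] whose moments are [f]. *)
Definition bernstein_weight (m k : nat) : R :=
  'C(m, k)%:R * iter (m - k) diffb f k.
Local Notation w := bernstein_weight.

Lemma bernstein_weight_ge0 m k : 0 <= w m k.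
Proof. by rewrite mulr_ge0 ?ler0n. Qed.

(** The moment functional is applied to ((1 - X) + s X)^m = (1 + (s - 1) X)^m, and both sides are
    expanded binomially. *)
Lemma bernstein_weight_gen m (s : R) :
  \sum_(k < m.+1) w m k * s ^+ k
  = \sum_(n < m.+1) 'C(m, n)%:R * (s - 1) ^+ n * f n.
Proof.
have binE (p : {poly R}) c n : p * (c *: 'X) ^+ n *+ 'C(m, n)
    = ('C(m, n)%:R * c ^+ n) *: ('X^n * p).
  by rewrite exprZn -scalerAr -scaler_nat scalerA [p * _]mulrC.
transitivity (moment f m.+1 (((1 - 'X) + s *: 'X) ^+ m)).
  rewrite exprDn moment_sum; apply: eq_bigr => k _.
  rewrite binE momentZ moment_bernstein; last by rewrite subnKC // -ltnS.
  by rewrite mulrAC.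
have -> : (1 - 'X) + s *: 'X = 1 + (s - 1) *: 'X :> {poly R}.
  by rewrite scalerBl scale1r; ring.
rewrite exprDn moment_sum; apply: eq_bigr => n _.
by rewrite binE momentZ expr1n mulr1 momentXn.
Qed.

Lemma bernstein_weight_sum m : \sum_(k < m.+1) w m k = 1.
Proof.
transitivity (\sum_(k < m.+1) w m k * 1 ^+ k).
  by apply: eq_bigr => k _; rewrite expr1n mulr1.
rewrite bernstein_weight_gen subrr big_ord_recl bin0 f0 !mul1r.
rewrite big1 ?addr0 // => k _.
by rewrite expr0n mulr0 mul0r.
Qed.

(** By k C(m+1, k) = (m+1) C(m, k-1), the sum is the functional at (m+1) X ((1 - X) + X)^m = (m+1)
    X. *)
Lemma bernstein_weight_mean m :
  \sum_(k < m.+2) w m.+1 k * k%:R = m.+1%:R * f 1%N.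
Proof.
rewrite big_ord_recl mulr0 add0r /=.
transitivity (moment f m.+2 (m.+1%:R *: ('X * ((1 - 'X) + 'X) ^+ m)));
  last first.
  by rewrite subrK expr1n mulr1 momentZ -[X in moment _ _ X]expr1 momentXn.
rewrite exprDn mulr_sumr scaler_sumr moment_sum; apply: eq_bigr => k _.
have -> : m.+1%:R *: ('X * ((1 - 'X) ^+ (m - k) * 'X ^+ k *+ 'C(m, k)))
   = (m.+1 * 'C(m, k))%:R *: ('X^(k.+1) * (1 - 'X) ^+ (m - k)) :> {poly R}.
  rewrite natrM -scalerA; congr (_ *: _).
  by rewrite scaler_nat exprS -[in LHS]mulr_natl -[in RHS]mulr_natl; ring.
rewrite momentZ moment_bernstein; last by rewrite addSn subnKC // -ltnS.
rewrite (mul_bin_diag m.+1 k) natrM /bernstein_weight /bump /= add1n subSS.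
by ring.
Qed.

Lemma bernstein_sum_bounds m (s : R) : 0 < s ->
  expR (f 1%N * ln (s ^+ m.+1))
    <= \sum_(k < m.+2) w m.+1 k * s ^+ k <= 1 - f 1%N + f 1%N * s ^+ m.+1.
Proof.
move=> s0; set l := ln s.
have sE k : s ^+ k = expR (k%:R * l) by rewrite expRM_natl lnK.
have M0 : m.+1%:R != 0 :> R by rewrite pnatr_eq0.
apply/andP; split.
  (* the tangent line of [expR] at the mean, i.e. Jensen's inequality *)
  pose y := m.+1%:R * f 1%N * l.
  have -> : f 1%N * ln (s ^+ m.+1) = y.
    by rewrite lnXn // -[ln s *+ _]mulr_natl /y -/l; ring.
  have -> : expR y = \sum_(k < m.+2) w m.+1 k * (expR y * (1 + (k%:R * l - y))).
    transitivity (expR y * (\sum_(k < m.+2) w m.+1 k * (1 - y)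
                            + \sum_(k < m.+2) w m.+1 k * k%:R * l)).
      rewrite -!mulr_suml bernstein_weight_sum bernstein_weight_mean /y.
      by ring.
    rewrite -big_split mulr_sumr; apply: eq_bigr => k _ /=; ring.
  apply: ler_sum => k _; apply: ler_wpM2l; first exact: bernstein_weight_ge0.
  have -> : s ^+ k = expR y * expR (k%:R * l - y).
    by rewrite sE -expRD; congr expR; ring.
  by apply: ler_wpM2l; [exact: expR_ge0 | exact: expR_ge1Dx].
(* The chord bound is affine in k, so total mass and mean determine its weighted sum; it is applied
   with th = k/(m+1) and u = (m+1) ln s. *)
have -> : 1 - f 1%N + f 1%N * s ^+ m.+1
    = \sum_(k < m.+2) w m.+1 k
        * (1 - k%:R / m.+1%:R + k%:R / m.+1%:R * s ^+ m.+1).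
  transitivity (\sum_(k < m.+2) w m.+1 k
     + \sum_(k < m.+2) w m.+1 k * k%:R * ((s ^+ m.+1 - 1) / m.+1%:R)).
    by rewrite -mulr_suml bernstein_weight_sum bernstein_weight_mean; field.
  by rewrite -big_split; apply: eq_bigr => k _ /=; ring.
apply: ler_sum => k _; apply: ler_wpM2l; first exact: bernstein_weight_ge0.
have -> : s ^+ k = expR (k%:R / m.+1%:R * (m.+1%:R * l)).
  by rewrite sE mulrA divfK.
rewrite sE; apply: expR_le_chord.
by rewrite divr_ge0 //= ler_pdivrMr ?ltr0n // mul1r ler_nat -ltnS.
Qed.

End Hausdorff.

(** * Passage from Bernstein sums to the exponential generating function *)

Lemma ffact_le_exp n m : (n ^_ m <= n ^ m)%N.
Proof.
by elim: m => // m IH; rewrite ffactnSr expnSr leq_mul ?leq_subr.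
Qed.

Section ExponentialGeneratingFunction.
Context {R : realType} {f : nat -> R}.
Hypotheses (cf : completely_monotone f) (f0 : f 0%N = 1).
Variable y : R.
Local Notation S := (pseries (fun n => f n / n`!%:R) y).
(** The generating function of the weights of order m+1 at s = 1 + y/(m+1). *)
Let G m := \sum_(n < m.+2) 'C(m.+1, n)%:R * (y / m.+1%:R) ^+ n * f n.

Lemma is_cvg_egf : cvgn S.
Proof.
apply: normed_cvg; apply: series_le_cvg (is_cvg_series_exp_coeff `|y|) => n.
- exact: normr_ge0.
- by rewrite /exp_coeff /= divr_ge0 ?exprn_ge0.
- rewrite /exp_coeff /= !normrM normrX normfV normr_nat -mulrA mulrC mulrAC.
  have /andP[fn0 fn1] := cm_le0 _ n cf.
  by rewrite ger0_norm // mulrC mulrA ler_piMr // ?divr_ge0 ?exprn_ge0 -?f0.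
Qed.

(** Termwise, C(m+1, n) / (m+1)^n <= 1/n! and 0 <= f n <= 1, so the worst case is f = 1 at |y|.
    There both sums are explicit and share the limit e^|y|. *)
Lemma dist_egf_bernstein m :
  `|S m.+2 - G m|
  <= series (exp_coeff `|y|) m.+2 - (1 + `|y| / m.+1%:R) ^+ m.+1.
Proof.
rewrite /pseries /G !seriesEord /= exprDn -!sumrB.
apply: (le_trans (ler_norm_sum _ _ _)); apply: ler_sum => n _.
rewrite /exp_coeff /= expr1n mul1r !exprMn exprVn.
have M0 : 0 < m.+1%:R :> R by rewrite ltr0n.
have F0 : 0 < n`!%:R :> R by rewrite ltr0n fact_gt0.
have /andP[fn0 fn1] := cm_le0 _ n cf.
have d0 : 0 <= n`!%:R^-1 - 'C(m.+1, n)%:R * (m.+1%:R ^+ n)^-1 :> R.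
  rewrite subr_ge0 ler_pdivrMr ?exprn_gt0 // ler_pdivlMl //.
  by rewrite -natrX -natrM ler_nat mulnC bin_ffact ffact_le_exp.
have -> : f n / n`!%:R * y ^+ n
     - 'C(m.+1, n)%:R * (y ^+ n * (m.+1%:R ^+ n)^-1) * f n
   = f n * (y ^+ n * (n`!%:R^-1 - 'C(m.+1, n)%:R * (m.+1%:R ^+ n)^-1)) by ring.
have -> : `|y| ^+ n / n`!%:R - `|y| ^+ n * (m.+1%:R ^+ n)^-1 *+ 'C(m.+1, n)
   = `|y| ^+ n * (n`!%:R^-1 - 'C(m.+1, n)%:R * (m.+1%:R ^+ n)^-1).
  by rewrite -mulr_natr; ring.
rewrite normrM (ger0_norm fn0) normrM normrX (ger0_norm d0).
by rewrite ler_piMl ?mulr_ge0 ?exprn_ge0 // -f0.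
Qed.

Lemma cvg_bernstein_egf : (G m @[m --> \oo] --> limn S)%classic.
Proof.
have shift2 (u : nat -> R) (l : R) : (u n @[n --> \oo] --> l)%classic ->
    (u n.+2 @[n --> \oo] --> l)%classic.
  by move=> ul; rewrite (cvg_shiftS (fun n => u n.+1)) (cvg_shiftS u).
have d0 : (S m.+2 - G m @[m --> \oo] --> (0 : R))%classic.
  apply/norm_cvg0P.
  apply: (squeeze_cvgr (f := fun=> 0) (h := fun m =>
     series (exp_coeff `|y|) m.+2 - (1 + `|y| / m.+1%:R) ^+ m.+1)).
  - by apply: nearW => m; rewrite normr_ge0 dist_egf_bernstein.
  - exact: cvg_cst.
  - rewrite -(subrr (expR `|y|)); apply: cvgB; last exact: cvg_expR_compound.
    apply: (shift2 (series (exp_coeff `|y|))).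
    exact: is_cvg_series_exp_coeff.
have -> : G = (fun m => S m.+2 - (S m.+2 - G m)).
  by apply/funext => m; rewrite subKr.
rewrite -[X in (_ --> X)%classic]subr0; apply: cvgB => //.
by apply: shift2; exact: is_cvg_egf.
Qed.

(** Limit of [bernstein_sum_bounds] at s = 1 + y/(m+1), which is positive for large m. *)
Lemma cm_egf_bounds : expR (f 1%N * y) <= limn S <= 1 - f 1%N + f 1%N * expR y.
Proof.
have compound := cvg_expR_compound y.
have pos : \forall m \near \oo%classic, 0 < 1 + y / m.+1%:R.
  exact: (cvgr_gt 1 (cvg_1D_div y)).
have bounds : \forall m \near \oo%classic,
    expR (f 1%N * ln ((1 + y / m.+1%:R) ^+ m.+1)) <= G m
      <= 1 - f 1%N + f 1%N * (1 + y / m.+1%:R) ^+ m.+1.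
  apply: filterS pos => m s0; have := bernstein_sum_bounds _ cf f0 m _ s0.
  rewrite bernstein_weight_gen.
  suff -> : 1 + y / m.+1%:R - 1 = y / m.+1%:R by [].
  by rewrite addrC addKr.
have lower : (expR (f 1%N * ln ((1 + y / m.+1%:R) ^+ m.+1)) @[m --> \oo]
    --> expR (f 1%N * y))%classic.
  apply: continuous_cvg; first exact: continuous_expR.
  apply: cvgM; first exact: cvg_cst.
  rewrite -[X in (_ --> X)%classic]expRK.
  exact: (continuous_cvg _ (continuous_ln (expR_gt0 y)) compound).
have upper : (1 - f 1%N + f 1%N * (1 + y / m.+1%:R) ^+ m.+1 @[m --> \oo]
    --> 1 - f 1%N + f 1%N * expR y)%classic.
  apply: cvgD; first exact: cvg_cst.
  by apply: cvgM; first exact: cvg_cst.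
apply/andP; split.
- apply: (ler_cvg_to lower cvg_bernstein_egf).
  by apply: filterS bounds => m /andP[].
- apply: (ler_cvg_to cvg_bernstein_egf upper).
  by apply: filterS bounds => m /andP[].
Qed.

End ExponentialGeneratingFunction.

(** * Weak supermajorization implies the power-sum inequality *)

(** Induction on [n]: as the partial sums of [d] are nonnegative, lowering their factor from [c n]
    to [c n.+1] can only decrease the left side. *)
Lemma abel_sum_ge {R : realDomainType} (n : nat) (c d : nat -> R) :
  (forall i, (i < n)%N -> c i.+1 <= c i) ->
  (forall k, (k <= n)%N -> 0 <= \sum_(i < k) d i) ->
  c n * \sum_(i < n.+1) d i <= \sum_(i < n.+1) c i * d i.
Proof.
elim: n => [|n IH] c_mono d_ge0; first by rewrite !big_ord1.
rewrite big_ord_recr /= [leRHS]big_ord_recr /= mulrDr lerD2r.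
apply: le_trans (IH _ _) => [|i /leqW|k /leqW]; [|exact: c_mono|exact: d_ge0].
by apply: ler_wpM2r; [exact: d_ge0 | exact: c_mono].
Qed.

(* Tomic's inequality for the convex decreasing function [x |-> t `^ x]. *)
Lemma weak_supermaj_powR {R : realType} (q : nat) (A B : q.-tuple R) (t : R) :
  weak_supermaj B A -> 0 < t <= 1 ->
  0 <= \sum_(j < q) (t `^ tnth A j - t `^ tnth B j).
Proof.
case: q A B => [|q] A B [_ _ AB] /andP[t0 t1]; first by rewrite big_ord0.
have sortE (C : q.+1.-tuple R) :
    \sum_(j < q.+1) t `^ tnth C j = \sum_(i < q.+1) t `^ (sort <=%R C)`_i.
  rewrite -(big_tuple _ _ C xpredT (fun x => t `^ x)).
  rewrite -(perm_big _ (permEl (perm_sort <=%R C))) (big_nth 0) big_mkord.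
  by rewrite size_sort size_tuple.
rewrite sumrB (sortE A) (sortE B) -sumrB.
move: AB; set a := sort _ A; set b := sort _ B => AB.
have l0 : ln t <= 0 by exact: ln_le0.
have powE x : t `^ x = expR (x * ln t) by rewrite /powR gt_eqF.
(* Minus the slope of x -> t^x at b_i; nonincreasing in i because [b] is sorted. *)
pose c i := - ln t * expR (b`_i * ln t).
have c_ge0 i : 0 <= c i by rewrite mulr_ge0 ?expR_ge0 ?oppr_ge0.
(* By convexity, t^(a_i) lies above the tangent at b_i. *)
apply: (@le_trans _ _ (\sum_(i < q.+1) c i * (b`_i - a`_i))); last first.
  apply: ler_sum => i _; rewrite !powE /c.
  have h : expR (b`_i * ln t) * (1 + (a`_i * ln t - b`_i * ln t))
      <= expR (a`_i * ln t).
    rewrite -[X in _ <= expR X](subrKC (b`_i * ln t)) expRD.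
    by apply: ler_wpM2l; [exact: expR_ge0 | exact: expR_ge1Dx].
  by move: h; lra.
apply: le_trans (_ : c q * \sum_(i < q.+1) (b`_i - a`_i) <= _).
  by rewrite mulr_ge0 // sumrB subr_ge0; apply: AB; rewrite leqnn.
apply: (abel_sum_ge q c (fun i => b`_i - a`_i)) => [i iq|k kq].
- apply: ler_wpM2l; first by rewrite oppr_ge0.
  rewrite ler_expR; apply: ler_wnM2r => //.
  apply: le_sorted_leq_nth => //; first exact: sort_le_sorted.
  + by rewrite inE size_sort size_tuple ltnS ltnW.
  + by rewrite inE size_sort size_tuple ltnS.
- case: k kq => [|k] kq; first by rewrite big_ord0.
  by rewrite sumrB subr_ge0; apply: AB; exact: leqW.
Qed.

(** * The bounds for [qFq], as the generating function of the Pochhammer ratios at -x *)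

Theorem theorem8 (R : realType) (q : nat) (A B : q.-tuple R)
  (q_ge1 : (1 <= q)%N)
  (A_gt0 : forall j : 'I_q, 0 < tnth A j)
  (B_gt0 : forall j : 'I_q, 0 < tnth B j)
  (AB : (forall t : R, 0 < t <= 1 ->
           0 <= \sum_(j < q) (t `^ tnth A j - t `^ tnth B j))
        \/ weak_supermaj B A) :
  let f1 := \prod_(i < q) (tnth A i / tnth B i) in
  forall x : R,
    expR (- f1 * x) <= qFq A B (- x) <= 1 - f1 + f1 * expR (- x).
Proof.
move=> f1 x.
have {AB} AB (t : R) : 0 < t <= 1 ->
    0 <= \sum_(j < q) (t `^ tnth A j - t `^ tnth B j).
  by case: AB => [|AB t01]; [exact | exact: weak_supermaj_powR].
pose f n := \prod_(j < q) (pochhammer (tnth A j) n / pochhammer (tnth B j) n).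
have cf : completely_monotone f by exact: cm_pochhammer_ratio.
have f0 : f 0%N = 1 by apply: big1 => j _; rewrite /pochhammer !big_ord0 divr1.
have -> : f1 = f 1%N.
  by apply: eq_bigr => j _; rewrite /pochhammer !big_ord1 !addr0.
have -> : qFq A B (- x) = limn (pseries (fun n => f n / n`!%:R) (- x)).
  congr (limn (pseries _ _)); apply/funext => n.
  by rewrite /qFq_coeff /f prodf_div invfM mulrA.
by rewrite mulNr -mulrN; exact: cm_egf_bounds.
Qed.
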